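(* Let $a$ be an element of a unital Banach algebra with $\mathrm{Sp}(a)\cap i\mathbb{R}=\emptyset$, and let $S=\mathrm{sign}(a)$. Then the Newton iterates $X_0=a$, $X_{k+1}=\frac12(X_k+X_k^{-1})$ (for $k\ge 0$) converge quadratically to $S$, and also $X_k^{-1}\to S$, with $$\|X_{k+1}-S\|\le\tfrac12\,\|X_k^{-1}\|\,\|X_k-S\|^2 ,$$ and $$X_k=(1-G_0^{2^k})^{-1}(1+G_0^{2^k})\,S \quad\text{for } k\ge1,$$ where $G_0=\kappa(N)$ and $N=(a^2)^{1/2}$.
   Context: Algebras are complex; a unital Banach algebra has an identity of norm $1$. If $x$ has spectrum disjoint from $(-\infty,0]$, then $x^{1/2}$ denotes the principal square root: the unique square root of $x$ with spectrum in the open right half plane; and $x^{-1/2}=(x^{1/2})^{-1}$. If $\mathrm{Sp}(a)\cap i\mathbb{R}=\emptyset$ then $\mathrm{Sp}(a^2)$ is disjoint from $(-\infty,0]$, and $\mathrm{sign}(a)=a\,(a^2)^{-1/2}$. The Cayley transform is $\kappa(x)=(x-1)(x+1)^{-1}$. The quadratic convergence is in the sense expressed by the displayed inequality. *)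

(* Defs.v *)
From HB Require Import structures.
From mathcomp Require Import all_boot all_order all_algebra.
From mathcomp Require Import complex.
From mathcomp Require Import boolp classical_sets functions filter reals.
From mathcomp Require Import topology normedtype sequences.

Set Implicit Arguments.
Unset Strict Implicit.
Unset Printing Implicit Defensive.

Import Order.TTheory GRing.Theory Num.Theory.

Local Open Scope classical_set_scope.
Local Open Scope ring_scope.
Local Open Scope complex_scope.

(* A plain record rather than an HB structure: HB rejects a structure joining
   normed modules over [K] with rings, because [Num.NumDomain] (a ring normed
   over itself) already claims that join.  The ring structure is therefore
   attached to the carrier [banach_sort] afterwards. *)
Record banachAlgebra (K : numFieldType) := BanachAlgebra {
  banach_base : completeNormedModType K;
  banach_one : banach_base;
  banach_mul : banach_base -> banach_base -> banach_base;
  banach_mulA : associative banach_mul;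
  banach_mul1 : left_id banach_one banach_mul;
  banach_mulr1 : right_id banach_one banach_mul;
  banach_mulDl : left_distributive banach_mul +%R;
  banach_mulDr : right_distributive banach_mul +%R;
  banach_scaleAl : forall (c : K) x y,
    c *: banach_mul x y = banach_mul (c *: x) y;
  banach_scaleAr : forall (c : K) x y,
    c *: banach_mul x y = banach_mul x (c *: y);
  banach_normM : forall x y, `|banach_mul x y| <= `|x| * `|y|;
  banach_norm1 : `|banach_one| = 1
}.

Definition banach_sort (K : numFieldType) (A : banachAlgebra K) : Type :=
  banach_base A.
Coercion banach_sort : banachAlgebra >-> Sortclass.

Section BanachAlgebraInstances.
Variables (K : numFieldType) (A : banachAlgebra K).

HB.instance Definition _ := CompleteNormedModule.on (banach_sort A).

Fact banach_one_neq0 : banach_one A != 0.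
Proof. by rewrite -normr_eq0 banach_norm1 oner_neq0. Qed.

HB.instance Definition _ := GRing.Zmodule_isNzRing.Build (banach_sort A)
  (@banach_mulA K A) (@banach_mul1 K A) (@banach_mulr1 K A)
  (@banach_mulDl K A) (@banach_mulDr K A) banach_one_neq0.

HB.instance Definition _ := GRing.Lmodule_isLalgebra.Build K (banach_sort A)
  (@banach_scaleAl K A).

HB.instance Definition _ := GRing.Lalgebra_isAlgebra.Build K (banach_sort A)
  (@banach_scaleAr K A).

Implicit Types x y : banach_sort A.

Definition banach_unit : pred (banach_sort A) :=
  fun x => `[< exists y, y * x = 1 /\ x * y = 1 >].

Definition banach_inv x : banach_sort A :=
  xget x [set y | y * x = 1 /\ x * y = 1].

Fact banach_invP x : banach_unit x ->
  banach_inv x * x = 1 /\ x * banach_inv x = 1.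
Proof.
by move=> /asboolP ux; exact: (xgetPex x (P := [set y | y * x = 1 /\ x * y = 1])).
Qed.

Fact banach_mulVr : {in banach_unit, left_inverse 1 banach_inv *%R}.
Proof. by move=> x /banach_invP[]. Qed.

Fact banach_divrr : {in banach_unit, right_inverse 1 banach_inv *%R}.
Proof. by move=> x /banach_invP[]. Qed.

Fact banach_unitrP x y : y * x = 1 /\ x * y = 1 -> banach_unit x.
Proof. by move=> yx; apply/asboolP; exists y. Qed.

Fact banach_invr_out : {in [predC banach_unit], banach_inv =1 id}.
Proof. by move=> x /asboolPn xN; apply: xgetPN => y yx; apply: xN; exists y. Qed.

HB.instance Definition _ := GRing.NzRing_hasMulInverse.Build (banach_sort A)
  banach_mulVr banach_divrr banach_unitrP banach_invr_out.

Lemma ler_normM x y : `|x * y| <= `|x| * `|y|.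
Proof. exact: banach_normM. Qed.

Lemma banach_normr1 : `|1 : banach_sort A| = 1.
Proof. exact: banach_norm1. Qed.

End BanachAlgebraInstances.

Section BanachAlgebraFunctions.
Variables (R : realType) (A : banachAlgebra R[i]).
Implicit Types x y a : A.

Definition spectrum x : set R[i] :=
  [set z | z%:A - x \isn't a GRing.unit].

Definition is_principal_sqrt x y : Prop :=
  y ^+ 2 = x /\ spectrum y `<=` [set z | 0 < complex.Re z].

(* [xget] chooses the principal square root; the default value [0] is only
   reached when there is none, which never happens when the spectrum of [x] is
   disjoint from the closed negative real axis. *)
Definition principal_sqrt x : A := xget 0 (is_principal_sqrt x).

Definition sign_of a : A := a * (principal_sqrt (a ^+ 2))^-1.

Definition cayley x : A := (x - 1) * (x + 1)^-1.

Fixpoint newton_iter a (k : nat) : A :=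
  if k is j.+1 then 2^-1 *: (newton_iter a j + (newton_iter a j)^-1) else a.

End BanachAlgebraFunctions.

(* Main.v *)
Require Import Defs.
From mathcomp Require Import all_boot all_order all_algebra.
From mathcomp Require Import complex.
From mathcomp Require Import boolp classical_sets functions filter reals.
From mathcomp Require Import topology normedtype sequences.
From mathcomp Require Import ring lra.

Set Implicit Arguments.
Unset Strict Implicit.
Unset Printing Implicit Defensive.

Import Order.TTheory GRing.Theory Num.Theory.
Import numFieldNormedType.Exports.

Local Open Scope classical_set_scope.
Local Open Scope ring_scope.
Local Open Scope complex_scope.

(* Put [p := a + 1], [q := a - 1].  Since [Sp a] avoids the imaginary axis,
   [p - z *: q] is invertible for every [z] on the unit circle, hence so is
   [p ^+ n - z *: q ^+ n] for [n := 2 ^ k], and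
   [F_k z := p ^+ n / (p ^+ n - z *: q ^+ n)] satisfies
   [F_(k+1) (z ^+ 2) = (F_k z + F_k (- z)) / 2 = F_k z * F_k (- z)].
   Taking square roots on the circle contracts distances, so averaging makes the
   Lipschitz constant of [F_k] decay geometrically: [F_k (+-1)] converges to an
   idempotent [e], the spectral projection of the right half plane.  The Newton
   iterates are [X_k = 2 F_k(1) - 1] with inverses [2 F_k(-1) - 1], so both
   converge to [s := 2 e - 1], and [a * s] is a square root of [a ^+ 2] with
   spectrum in the right half plane.  Two principal square roots [y], [y'] of the
   same element agree: [d := y - y'] satisfies [y d = - d y'], that is
   [d = cayley y * d * cayley y'], and powers of the Cayley transforms tend to
   [0] (the spectral radius formula along the exponents [2 ^ k], again from the
   averaging identity).  Hence [N = a * s] and [sign a = s]. *)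

(** * Real-valued norms *)

Section RealNorm.
Variable R : realType.

(* Norms over [R[i]] are [R[i]]-valued; the real-valued copy gives access to the
   decision procedures for ordered fields. *)
Definition rnorm (V : normedZmodType R[i]) (x : V) : R := complex.Re `|x|.

Lemma rnormE (V : normedZmodType R[i]) (x : V) : `|x| = (rnorm x)%:C.
Proof. by rewrite /rnorm RRe_real // ger0_real. Qed.

Section NormedZmod.
Variable V : normedZmodType R[i].
Implicit Types x y : V.

Lemma rnorm_ge0 x : 0 <= rnorm x.
Proof. by rewrite -ler0c -rnormE. Qed.

Lemma ler_rnormD x y : rnorm (x + y) <= rnorm x + rnorm y.
Proof. by rewrite -lecR rmorphD /= -!rnormE ler_normD. Qed.

Lemma rnormN x : rnorm (- x) = rnorm x.
Proof. by rewrite /rnorm normrN. Qed.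

Lemma rdistC x y : rnorm (x - y) = rnorm (y - x).
Proof. by rewrite /rnorm distrC. Qed.

Lemma ler_rnormB x y : rnorm (x - y) <= rnorm x + rnorm y.
Proof. by rewrite -(rnormN y) ler_rnormD. Qed.

Lemma rnorm0 : rnorm (0 : V) = 0.
Proof. by rewrite /rnorm normr0. Qed.

Lemma rnorm0_eq0 x : rnorm x = 0 -> x = 0.
Proof. by move=> x0; apply/normr0_eq0; rewrite rnormE x0. Qed.

End NormedZmod.

Lemma rnormZ (V : normedModType R[i]) (z : R[i]) (x : V) :
  rnorm (z *: x) = rnorm z * rnorm x.
Proof. by apply/complexI; rewrite rmorphM /= -!rnormE normrZ. Qed.

Lemma rnormMc (z w : R[i]) : rnorm (z * w) = rnorm z * rnorm w.
Proof. by apply/complexI; rewrite rmorphM /= -!rnormE normrM. Qed.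

Lemma rnormC (t : R) : rnorm (t%:C : R[i]) = `|t|.
Proof. by rewrite /rnorm normc_def /= expr0n addr0 sqrtr_sqr. Qed.

Lemma rnorm1 : rnorm (1 : R[i]) = 1.
Proof. by rewrite /rnorm normr1. Qed.

Lemma sqr_rnorm (z : R[i]) :
  rnorm z ^+ 2 = complex.Re z ^+ 2 + complex.Im z ^+ 2.
Proof. by apply/complexI; rewrite rmorphXn /= -rnormE -add_Re2_Im2. Qed.

Lemma rnorm2V : rnorm (2^-1 : R[i]) = 2^-1.
Proof.
have -> : 2^-1 = (2^-1)%:C :> R[i] by rewrite fmorphV /= rmorph_nat.
by rewrite rnormC ger0_norm ?invr_ge0.
Qed.

Lemma rnorm_sqrtc1 (z : R[i]) : rnorm z = 1 -> rnorm (sqrtc z) = 1.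
Proof.
move=> z1; apply/eqP; rewrite -(@pexpr_eq1 _ (rnorm _) 2) ?rnorm_ge0 //.
by rewrite expr2 -rnormMc -expr2 sqr_sqrtc z1.
Qed.

Lemma rparallelogram (z w : R[i]) :
  rnorm (z + w) ^+ 2 + rnorm (z - w) ^+ 2 = 2 * (rnorm z ^+ 2 + rnorm w ^+ 2).
Proof.
rewrite !sqr_rnorm; case: z w => [x y] [u v] /=; rewrite /=.
by lra.
Qed.

(* Choose the sign of [w'] so that [rnorm (z' - w') <= rnorm (z' + w')]; the
   parallelogram law gives [rnorm (z' + w') >= Num.sqrt 2 >= 4 / 3], while
   [rnorm (z - w) = rnorm (z' - w') * rnorm (z' + w')]. *)
Lemma sqrtc_contraction (z w : R[i]) : rnorm z = 1 -> rnorm w = 1 ->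
  exists z' w', [/\ z' ^+ 2 = z, w' ^+ 2 = w, rnorm z' = 1, rnorm w' = 1
    & rnorm (z' - w') <= 3 / 4 * rnorm (z - w)].
Proof.
move=> z1 w1; set z' := sqrtc z; set w' := sqrtc w.
have nz' : rnorm z' = 1 by exact: rnorm_sqrtc1.
have nw' : rnorm w' = 1 by exact: rnorm_sqrtc1.
have zz' : z' ^+ 2 = z by exact: sqr_sqrtc.
have ww' : w' ^+ 2 = w by exact: sqr_sqrtc.
have P := rparallelogram z' w'; rewrite nz' nw' in P.
have E : rnorm (z - w) = rnorm (z' - w') * rnorm (z' + w').
  by rewrite -rnormMc -subr_sqr zz' ww'.
have p0 := rnorm_ge0 (z' + w'); have m0 := rnorm_ge0 (z' - w').
have [le|/ltW le] := leP (rnorm (z' - w')) (rnorm (z' + w')).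
  exists z', w'; split => //; rewrite E; nra.
exists z', (- w'); split; rewrite ?sqrrN ?rnormN // opprK E; nra.
Qed.

End RealNorm.

(** * Convergence in Banach algebras *)

Section Convergence.
Variable R : realType.

Lemma cvg_rnorm (V : normedModType R[i]) (u : nat -> V) (l : V) :
  (u k @[k --> \oo] --> l) <-> (rnorm (u k - l) @[k --> \oo] --> (0 : R)).
Proof.
split=> [/cvgrPdist_lt ul|/cvgr0Pnorm_lt ul].
  apply/cvgr0Pnorm_lt => e e0.
  have := ul e%:C; rewrite ltcR => /(_ e0); apply: filterS => k.
  by rewrite distrC rnormE ltcR ger0_norm ?rnorm_ge0.
apply/cvgrPdist_lt => e e0.
have eE : e = (complex.Re e)%:C by rewrite RRe_real // gtr0_real.
move: (e0); rewrite eE ltcR => /ul; apply: filterS => k.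
by rewrite distrC rnormE ltcR ger0_norm ?rnorm_ge0.
Qed.

Lemma cvg_rnorm_le (V : normedModType R[i]) (u : nat -> V) (l : V) (v : nat -> R) :
  v k @[k --> \oo] --> 0 -> (\forall k \near \oo, rnorm (u k - l) <= v k) ->
  u k @[k --> \oo] --> l.
Proof.
move=> v0 uv; apply/cvg_rnorm; apply: (squeeze_cvgr _ _ v0); last exact: cvg_cst.
by apply: filterS uv => k ->; rewrite rnorm_ge0.
Qed.

Lemma cvg_rnorm_bounded (V : normedModType R[i]) (u : nat -> V) (l : V) :
  u k @[k --> \oo] --> l -> exists M, forall k, rnorm (u k) <= M.
Proof.
move=> /cvg_rnorm /cvgP /cvg_seq_bounded /pinfty_ex_gt0[M _ /= uM].
exists (M + rnorm l) => k.
have := uM k I; rewrite /= ger0_norm ?rnorm_ge0 // => {}uM.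
by rewrite -[u k](subrK l) (le_trans (ler_rnormD _ _)) // lerD2r.
Qed.

Lemma cvg_geometric_increment (V : completeNormedModType R[i]) (u : nat -> V)
    (C q : R) : 0 <= q < 1 -> (forall k, rnorm (u k.+1 - u k) <= C * q ^+ k) ->
  cvg (u k @[k --> \oo]).
Proof.
move=> /andP[q0 q1] uC.
have C0 : 0 <= C.
  by have := uC 0%N; rewrite expr0 mulr1; apply: le_trans; exact: rnorm_ge0.
(* [D] is the sum of the whole geometric series; the factor [1 - q ^+ k] in the bound below lets the
   induction on [k] close exactly. *)
pose D := C / (1 - q).
have DE : C = D * (1 - q) by rewrite /D divfK // subr_eq0 gt_eqF.
have D0 : 0 <= D by rewrite divr_ge0 // subr_ge0 ltW.
have dist m k : rnorm (u (m + k)%N - u m) <= D * q ^+ m * (1 - q ^+ k).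
  elim: k => [|k IH]; first by rewrite addn0 expr0 !subrr mulr0 rnorm0.
  rewrite addnS -(subrKA (u (m + k)%N)).
  apply: le_trans (ler_rnormD _ _) _; have := uC (m + k)%N.
  rewrite {1}DE exprD exprS; nra.
have Dq : D * q ^+ k @[k --> \oo] --> (0 : R).
  by apply: (@cvg_geometric R D q); rewrite ger0_norm.
apply/cauchy_cvgP; apply: cauchy_exP => e e0.
have eE : e = (complex.Re e)%:C by rewrite RRe_real // gtr0_real.
move: e0; rewrite eE ltcR => e0.
move/cvgr0Pnorm_lt : Dq => /(_ _ e0) [m _ /(_ m (leqnn m)) Dm].
exists (u m); exists m => // k /= mk.
rewrite -ball_normE /= distrC rnormE ltcR; apply: le_lt_trans Dm.
rewrite (ger0_norm (mulr_ge0 D0 (exprn_ge0 _ q0))) -(subnKC mk).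
by rewrite (le_trans (dist _ _)) // ler_piMr ?gerBl ?exprn_ge0 // mulr_ge0 ?exprn_ge0.
Qed.

Section Algebra.
Variable A : banachAlgebra R[i].
Implicit Types x y : A.

Lemma ler_rnormM x y : rnorm (x * y) <= rnorm x * rnorm y.
Proof. by rewrite -lecR rmorphM /= -!rnormE ler_normM. Qed.

Lemma rnormA1 : rnorm (1 : A) = 1.
Proof. by rewrite /rnorm banach_normr1. Qed.

Lemma cvg_mul (u v : nat -> A) (l m : A) :
  u k @[k --> \oo] --> l -> v k @[k --> \oo] --> m ->
  u k * v k @[k --> \oo] --> l * m.
Proof.
move=> ul vm; have [M vM] := cvg_rnorm_bounded vm.
apply: (@cvg_rnorm_le _ _ _
    (fun k => rnorm (u k - l) * M + rnorm l * rnorm (v k - m))).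
  rewrite -[0](_ : 0 * M + rnorm l * 0 = 0); last by rewrite mul0r mulr0 addr0.
  apply: cvgD; first by apply: cvgMr_tmp; apply/cvg_rnorm.
  by apply: cvgMl_tmp; apply/cvg_rnorm.
apply: nearW => k.
have -> : u k * v k - l * m = (u k - l) * v k + l * (v k - m).
  by rewrite mulrBl mulrBr addrA subrK.
apply: le_trans (ler_rnormD _ _) _; apply: lerD; last exact: ler_rnormM.
by apply: le_trans (ler_rnormM _ _) _; rewrite ler_wpM2l ?rnorm_ge0.
Qed.

(** Neumann series: the partial sums [s k] converge, and both products with [1 - x] are
    [1 - x ^+ k], which tends to [1]. *)
Lemma unitr_sub1 x : rnorm x < 1 -> 1 - x \is a GRing.unit.
Proof.
move=> x1; pose s k := \sum_(i < k) x ^+ i.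
have xk k : rnorm (x ^+ k) <= rnorm x ^+ k.
  elim: k => [|k IH]; first by rewrite !expr0 rnormA1.
  rewrite !exprS (le_trans (ler_rnormM _ _)) // ler_wpM2l ?rnorm_ge0 //.
have sc : cvg (s k @[k --> \oo]).
  apply: (@cvg_geometric_increment _ _ 1 (rnorm x)); first by rewrite rnorm_ge0.
  by move=> k; rewrite /s big_ord_recr /= addrAC subrr add0r mul1r.
have xk0 : x ^+ k @[k --> \oo] --> (0 : A).
  apply: (@cvg_rnorm_le _ _ _ (fun k => rnorm x ^+ k)).
    by apply: cvg_expr; rewrite ger0_norm ?rnorm_ge0.
  by apply: nearW => k; rewrite subr0.
have x10 : 1 - x ^+ k @[k --> \oo] --> (1 : A).
  by rewrite -[1 in X in _ --> X](subr0 (1 : A)); apply: cvgB => //; exact: cvg_cst.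
have sE k : (1 - x) * s k = 1 - x ^+ k.
  by rewrite -opprB mulNr -subrX1 opprB.
have sC k : s k * (1 - x) = 1 - x ^+ k.
  rewrite -sE; apply/commr_sym/commr_sum => i _.
  exact/commrX/commr_sym/commrB/commr_refl/commr1.
apply/unitrP; exists (lim (s k @[k --> \oo])); split.
  apply: (@cvg_unique A (@norm_hausdorff _ A) _ _ _ _ _ x10).
  rewrite -(funext sC); apply: cvg_mul => //; exact: cvg_cst.
apply: (@cvg_unique A (@norm_hausdorff _ A) _ _ _ _ _ x10).
rewrite -(funext sE); apply: cvg_mul => //; exact: cvg_cst.
Qed.

End Algebra.
End Convergence.

(** * Resolvents on annuli *)

Section Resolvent.
Variables (R : realType) (A : banachAlgebra R[i]).
Implicit Types p q : A.

(** In [v^-1 = u^-1 + v^-1 * (u - v) * u^-1] the last term has at most half the norm of [v^-1] and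
    is absorbed on the left. *)
Lemma rnorm_invr_le (u v : A) : u \is a GRing.unit -> v \is a GRing.unit ->
  rnorm (u - v) * rnorm u^-1 <= 2^-1 -> rnorm v^-1 <= 2 * rnorm u^-1.
Proof.
move=> uU vU uv.
have E : v^-1 = u^-1 + v^-1 * (u - v) * u^-1.
  by rewrite mulrBr mulrBl mulVr // mul1r mulrK // addrC subrK.
have : rnorm v^-1 <= rnorm u^-1 + rnorm v^-1 * (rnorm (u - v) * rnorm u^-1).
  rewrite {1}E; apply: le_trans (ler_rnormD _ _) _; rewrite lerD2l -mulrA.
  apply: le_trans (ler_rnormM _ _) _; rewrite ler_wpM2l ?rnorm_ge0 //.
  exact: ler_rnormM.
have := rnorm_ge0 v^-1; nra.
Qed.

Lemma annulus_compact (r : R) :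
  compact [set w : R * R | r <= rnorm (w.1 +i* w.2) ^+ 2 <= 1].
Proof.
have -> : [set w : R * R | r <= rnorm (w.1 +i* w.2) ^+ 2 <= 1] =
    (fun w : R * R => w.1 ^+ 2 + w.2 ^+ 2) @^-1` `[r, 1]%classic.
  by apply/seteqP; split=> w /=; rewrite sqr_rnorm in_itv.
have cl : closed ((fun w : R * R => w.1 ^+ 2 + w.2 ^+ 2) @^-1` `[r, 1]%classic).
  apply: closed_comp; last exact: interval_closed.
  move=> w _; apply: cvgD; rewrite expr2; apply: cvgM.
  - exact: cvg_fst.
  - exact: cvg_fst.
  - exact: cvg_snd.
  - exact: cvg_snd.
apply: (subclosed_compact cl
  (compact_setX (@segment_compact R (-1) 1) (@segment_compact R (-1) 1))).
by move=> [s t] /=; rewrite !in_itv /= => /andP[_ st]; split; nra.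
Qed.

(** Compactness turns the local bounds of [rnorm_invr_le] into a global one. The case [r = 1] is the
    circle, [r = 0] the closed disc. *)
Lemma bounded_resolvent (r : R) p q :
    (forall z : R[i], r <= rnorm z ^+ 2 <= 1 -> p - z *: q \is a GRing.unit) ->
  exists M, forall z : R[i], r <= rnorm z ^+ 2 <= 1 ->
    rnorm (p - z *: q)^-1 <= M.
Proof.
move=> U; have /compact_near_coveringP := @annulus_compact r.
move=> /(_ R (pinfty_nbhs R) (fun M w => r <= rnorm (w.1 +i* w.2) ^+ 2 <= 1 ->
  rnorm (p - (w.1 +i* w.2) *: q)^-1 <= M) _) [|M [_ MP]].
  move=> [s t] /= st; set z := s +i* t in st *.
  pose d := rnorm (p - z *: q)^-1; pose D := rnorm q * d.
  have D0 : 0 <= D by rewrite mulr_ge0 ?rnorm_ge0.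
  (* With this radius [e] the point moves by at most [2 * e], and [2 * e * D <= 2^-1] is the
     smallness that [rnorm_invr_le] asks for. *)
  exists (ball (s, t) (4 * (1 + D))^-1, [set M | 2 * d <= M]).
    split => /=; last by apply: nbhs_pinfty_ge; rewrite num_real.
    by apply: nbhsx_ballx; rewrite invr_gt0; lra.
  move=> [[s' t'] M] /= [[/= ds dt] dM] K; apply: le_trans dM.
  apply: rnorm_invr_le; rewrite ?U //.
  have -> : p - z *: q - (p - (s' +i* t') *: q) = ((s' - s) +i* (t' - t)) *: q.
    by rewrite opprB addrC addrA subrK -scalerBl.
  rewrite rnormZ -mulrA -/d -/D; set x := rnorm _.
  have x2 : x ^+ 2 = (s' - s) ^+ 2 + (t' - t) ^+ 2 by rewrite sqr_rnorm.
  have x0 : 0 <= x by exact: rnorm_ge0.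
  have De : (4 * (1 + D))^-1 * (4 * (1 + D)) = 1.
    by rewrite mulVf // mulf_neq0 // gt_eqF //; lra.
  move: (4 * (1 + D))^-1 De ds dt => e De.
  rewrite /ball /= !ltr_norml => /andP[s1 s2] /andP[t1 t2].
  have xe : x <= 2 * e by nra.
  nra.
exists (M + 1) => -[s t] st; apply: (MP (M + 1) _ (s, t)) => //.
by rewrite ltrDl.
Qed.
End Resolvent.

(** * Dyadic quotients *)

Section DyadicQuotient.
Variables (R : realType) (A : banachAlgebra R[i]).
Implicit Types (p q x : A) (z w : R[i]) (k : nat).

Definition dyadic_den p q k z : A := p ^+ (2 ^ k) - z *: q ^+ (2 ^ k).

(** [p] and [q] stay separate because [a + 1] is singular when [-1] lies in the spectrum of [a]. In
    scalar terms the limit in [k] is [1] where [|p| > |q|] and [0] where [|p| < |q|]. *)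
Definition dyadic_quot p q k z : A := p ^+ (2 ^ k) * (dyadic_den p q k z)^-1.

Definition circle_unit p q := forall z, rnorm z = 1 -> p - z *: q \is a GRing.unit.

Lemma splitr1 : 1 = 2^-1 + 2^-1 :> R[i].
Proof. by rewrite [LHS]splitr !mul1r. Qed.

Lemma commrZ (c : R[i]) x p : GRing.comm x p -> GRing.comm x (c *: p).
Proof. by move=> xp; rewrite /GRing.comm -scalerAr xp scalerAl. Qed.

Lemma commr_dyadic_den p q k z x : GRing.comm x p -> GRing.comm x q ->
  GRing.comm x (dyadic_den p q k z).
Proof. by move=> xp xq; apply: commrB; [|apply: commrZ]; exact: commrX. Qed.

Lemma commr_dyadic_quot p q k z x : GRing.comm x p -> GRing.comm x q ->
  GRing.comm x (dyadic_quot p q k z).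
Proof.
move=> xp xq; apply: commrM; first exact: commrX.
exact/commrV/commr_dyadic_den.
Qed.

Lemma rnorm_invrB (u v : A) : u \is a GRing.unit -> v \is a GRing.unit ->
  rnorm (u^-1 - v^-1) <= rnorm u^-1 * rnorm (u - v) * rnorm v^-1.
Proof.
move=> uU vU; have -> : u^-1 - v^-1 = u^-1 * (v - u) * v^-1.
  by rewrite mulrBr mulrBl mulVr // mul1r mulrK.
rewrite rdistC; apply: le_trans (ler_rnormM _ _) _.
by rewrite ler_wpM2r ?rnorm_ge0 ?ler_rnormM.
Qed.

Section Commuting.
Variables p q : A.
Hypotheses (pq : GRing.comm p q) (pqU : circle_unit p q).

Let comm_exp_den k z : GRing.comm (p ^+ (2 ^ k)) (dyadic_den p q k z).
Proof.
apply: commr_dyadic_den; apply/commr_sym/commrX => //; exact: commr_sym.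
Qed.

Let comm_den k z w : GRing.comm (dyadic_den p q k z) (dyadic_den p q k w).
Proof.
by apply: commr_dyadic_den; apply/commr_sym/commr_dyadic_den => //; exact: commr_sym.
Qed.

(** Difference of squares, which is where [p] and [q] must commute: the two square roots of a point
    carry level [k] to level [k.+1]. *)
Lemma dyadic_denM k z :
  dyadic_den p q k z * dyadic_den p q k (- z) = dyadic_den p q k.+1 (z ^+ 2).
Proof.
have PQ : GRing.comm (p ^+ (2 ^ k)) (q ^+ (2 ^ k)).
  by apply/commrX/commr_sym/commrX/commr_sym.
rewrite /dyadic_den expnSr !exprM scaleNr opprK mulrBl !mulrDr -!scalerAl -!scalerAr.
by rewrite PQ -!expr2 scalerA -expr2 opprD addrA addrK.
Qed.

Lemma dyadic_den_unit k z : rnorm z = 1 -> dyadic_den p q k z \is a GRing.unit.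
Proof.
elim: k z => [|k IH] z z1; first by rewrite /dyadic_den !expr1 pqU.
rewrite -[z]sqr_sqrtc -dyadic_denM unitrMl IH ?rnormN ?rnorm_sqrtc1 //.
Qed.

Lemma dyadic_denD k z :
  dyadic_den p q k z + dyadic_den p q k (- z) = p ^+ (2 ^ k) *+ 2.
Proof. by rewrite /dyadic_den scaleNr opprK addrACA addNr addr0 mulr2n. Qed.

Lemma dyadic_quotM k z : rnorm z = 1 ->
  dyadic_quot p q k z * dyadic_quot p q k (- z) = dyadic_quot p q k.+1 (z ^+ 2).
Proof.
move=> z1; have uU := dyadic_den_unit k z1.
have vU : dyadic_den p q k (- z) \is a GRing.unit by rewrite dyadic_den_unit ?rnormN.
rewrite /dyadic_quot -dyadic_denM comm_den invrM //.
rewrite expnSr exprM expr2 -!mulrA; congr (_ * _); rewrite !mulrA; congr (_ * _).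
exact/commr_sym/commrV/comm_exp_den.
Qed.

(** For the denominators [u], [v] at [z] and [- z], [u^-1 + v^-1 = (u + v) * (u * v)^-1], and
    [u + v] is twice the numerator. *)
Lemma dyadic_quotD k z : rnorm z = 1 ->
  dyadic_quot p q k z + dyadic_quot p q k (- z) =
  dyadic_quot p q k.+1 (z ^+ 2) *+ 2.
Proof.
move=> z1; have uU := dyadic_den_unit k z1.
have vU : dyadic_den p q k (- z) \is a GRing.unit by rewrite dyadic_den_unit ?rnormN.
rewrite /dyadic_quot -dyadic_denM -mulrDr expnSr exprM expr2 -mulrA -mulrnAr.
congr (_ * _); rewrite -mulrnAl -(dyadic_denD k z) mulrDl addrC.
by rewrite {1}comm_den !invrM // !mulVKr.
Qed.

Lemma dyadic_quotS k z : rnorm z = 1 -> dyadic_quot p q k.+1 (z ^+ 2) =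
  2^-1 *: (dyadic_quot p q k z + dyadic_quot p q k (- z)).
Proof.
move=> z1; rewrite dyadic_quotD // -[dyadic_quot _ _ _ _ *+ 2]scaler_nat.
by rewrite scalerA mulVf ?scale1r ?pnatr_eq0.
Qed.

(** Since [u + v] is twice the numerator, the two elements are [v * u^-1] and [u * v^-1]. *)
Lemma dyadic_newton_invr k :
  2 *: dyadic_quot p q k 1 - 1 \is a GRing.unit /\
  (2 *: dyadic_quot p q k 1 - 1)^-1 = 2 *: dyadic_quot p q k (- 1) - 1.
Proof.
set u := dyadic_den p q k 1; set v := dyadic_den p q k (- 1).
have uU : u \is a GRing.unit by rewrite dyadic_den_unit ?rnorm1.
have vU : v \is a GRing.unit by rewrite dyadic_den_unit ?rnormN ?rnorm1.
have uv : u + v = p ^+ (2 ^ k) *+ 2 by exact: dyadic_denD.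
have -> : 2 *: dyadic_quot p q k 1 - 1 = v * u^-1.
  rewrite scalerAl scaler_nat -uv -[X in _ - X](mulrV uU) -mulrBl.
  by rewrite addrC addKr.
have -> : 2 *: dyadic_quot p q k (- 1) - 1 = u * v^-1.
  rewrite scalerAl scaler_nat -uv -[X in _ - X](mulrV vU) -mulrBl.
  by rewrite addrK.
by rewrite unitrMl ?unitrV // invrM ?unitrV // invrK.
Qed.

Lemma newton_iter_dyadic k :
  newton_iter (2 *: dyadic_quot p q 0 1 - 1) k = 2 *: dyadic_quot p q k 1 - 1.
Proof.
elim: k => //= k ->; have [_ ->] := dyadic_newton_invr k.
rewrite -[X in dyadic_quot _ _ k.+1 X](expr1n _ 2) dyadic_quotS ?rnorm1 //.
rewrite scalerA mulfV ?pnatr_eq0 // scale1r addrACA -scalerDr -opprD scalerBr.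
by rewrite scalerA mulVf ?pnatr_eq0 // scale1r scalerDr -scalerDl -splitr1 scale1r.
Qed.

Lemma dyadic_quot_lipschitz : exists L, forall k z w, rnorm z = 1 -> rnorm w = 1 ->
  rnorm (dyadic_quot p q k z - dyadic_quot p q k w) <=
    L * (3 / 4) ^+ k * rnorm (z - w).
Proof.
have [|M MP] := @bounded_resolvent R A 1 p q.
  move=> z /le_anti z1; apply: pqU; apply/eqP.
  by rewrite -(@pexpr_eq1 _ (rnorm z) 2) ?rnorm_ge0 // -z1.
pose L := rnorm p * (M * rnorm q * M).
have M0 : 0 <= M.
  by apply: le_trans (MP 1 _); rewrite ?rnorm_ge0 // rnorm1 expr1n lexx.
have L0 : 0 <= L by rewrite !mulr_ge0 ?rnorm_ge0.
have M1 z : rnorm z = 1 -> rnorm (p - z *: q)^-1 <= M.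
  by move=> z1; apply: MP; rewrite z1 expr1n lexx.
exists L; elim=> [|k IH] z w z1 w1.
  rewrite expr0 mulr1 /dyadic_quot /dyadic_den !expr1 -mulrBr /L -!mulrA.
  apply: le_trans (ler_rnormM _ _) _; rewrite ler_wpM2l ?rnorm_ge0 //.
  apply: le_trans (rnorm_invrB (pqU z1) (pqU w1)) _.
  have -> : p - z *: q - (p - w *: q) = (w - z) *: q.
    by rewrite opprB addrC addrA subrK -scalerBl.
  rewrite rnormZ rdistC.
  have ab : rnorm (p - z *: q)^-1 * rnorm (p - w *: q)^-1 <= M * M.
    by rewrite ler_pM ?rnorm_ge0 ?M1.
  have c0 : 0 <= rnorm q * rnorm (z - w) by rewrite mulr_ge0 ?rnorm_ge0.
  have := ler_wpM2l c0 ab; lra.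
(* The pairs [z'], [w'] and [- z'], [- w'] both lie at the contracted distance, so the average
   inherits the factor [3 / 4]. *)
have [z' [w' [<- <- z'1 w'1 le]]] := sqrtc_contraction z1 w1.
rewrite !dyadic_quotS // -scalerBr opprD addrACA rnormZ rnorm2V exprSr [L * _]mulrA.
have := ler_rnormD (dyadic_quot p q k z' - dyadic_quot p q k w')
  (dyadic_quot p q k (- z') - dyadic_quot p q k (- w')).
have := IH _ _ z'1 w'1; have := IH (- z') (- w').
rewrite !rnormN -[- z' - _]opprD rnormN => /(_ z'1 w'1).
have : 0 <= L * (3 / 4) ^+ k by rewrite mulr_ge0 // exprn_ge0 //; lra.
set K := L * _ => K0 h1 h2 h3.
have := ler_wpM2l K0 le. lra.
Qed.

(** By averaging, the increment at [1] is half the difference of the values at [- 1] and [1], which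
    the Lipschitz bound makes geometric. The product identity makes the limit idempotent. *)
Lemma dyadic_quot_cvg : exists e : A,
  [/\ dyadic_quot p q k 1 @[k --> \oo] --> e,
      dyadic_quot p q k (- 1) @[k --> \oo] --> e & e * e = e].
Proof.
pose d k := dyadic_quot p q k 1; pose d' k := dyadic_quot p q k (- 1).
have dS k : d k.+1 = 2^-1 *: (d k + d' k).
  by rewrite /d -[X in dyadic_quot _ _ k.+1 X](expr1n _ 2) dyadic_quotS ?rnorm1.
have dM k : d k.+1 = d k * d' k.
  by rewrite /d -[X in dyadic_quot _ _ k.+1 X](expr1n _ 2) dyadic_quotM ?rnorm1.
have [L LP] := dyadic_quot_lipschitz.
have cd : cvg (d k @[k --> \oo]).
  apply: (@cvg_geometric_increment _ _ _ (2^-1 * (L * rnorm (- 1 - 1 : R[i]))) (3 / 4)).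
    by apply/andP; split; lra.
  move=> k; have -> : d k.+1 - d k = 2^-1 *: (d' k - d k).
    have dk : d k = 2^-1 *: d k + 2^-1 *: d k.
      by rewrite -scalerDl -splitr1 scale1r.
    rewrite dS [d k in X in _ - X]dk -scalerDr.
    by rewrite -scalerBr opprD addrACA subrr add0r.
  rewrite rnormZ rnorm2V -mulrA ler_pM2l ?invr_gt0 //.
  by rewrite -mulrA [_ * _ ^+ k]mulrC mulrA LP ?rnormN ?rnorm1.
have [e de] : exists e : A, d k @[k --> \oo] --> e by exists (lim (d k @[k --> \oo])).
have dSe : d k.+1 @[k --> \oo] --> e by rewrite -(cvg_shiftS d) in de.
have d'e : d' k @[k --> \oo] --> e.
  have -> : d' = (fun k => 2 *: d k.+1 - d k).
    apply/funext => k; rewrite dS scalerA mulfV ?pnatr_eq0 // scale1r.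
    by rewrite addrC addKr.
  rewrite -[e in X in _ --> X](_ : 2 *: e - e = e); last first.
    by rewrite scaler_nat mulr2n addrK.
  by apply: cvgB => //; exact: cvgZl_tmp.
exists e; split => //.
apply: (@cvg_unique A (@norm_hausdorff _ A) _ _ _ _ _ dSe).
by rewrite (funext dM); apply: cvg_mul.
Qed.

End Commuting.

(** Averaging over square roots cannot increase a uniform distance on the circle. Hence the limit
    idempotents vary continuously with [p] and [q]. *)
Lemma dyadic_quot_dist p q p' q' L : GRing.comm p q -> circle_unit p q ->
    GRing.comm p' q' -> circle_unit p' q' ->
    (forall z, rnorm z = 1 ->
      rnorm (dyadic_quot p q 0 z - dyadic_quot p' q' 0 z) <= L) ->
  forall k z, rnorm z = 1 ->
    rnorm (dyadic_quot p q k z - dyadic_quot p' q' k z) <= L.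
Proof.
move=> pq pqU pq' pqU' d0; elim=> [|k IH] z z1; first exact: d0.
rewrite -[z]sqr_sqrtc !dyadic_quotS ?rnorm_sqrtc1 // -scalerBr opprD addrACA.
rewrite rnormZ rnorm2V; set u := _ - _; set v := _ - _.
have := IH _ (rnorm_sqrtc1 z1); have := IH (- sqrtc z).
rewrite rnormN => /(_ (rnorm_sqrtc1 z1)).
have := ler_rnormD u v; rewrite -/u -/v; lra.
Qed.

End DyadicQuotient.

(** * Spectral radius and uniqueness of principal square roots *)

Section SpectralRadius.
Variables (R : realType) (A : banachAlgebra R[i]).
Implicit Types (x y e : A) (z : R[i]).

Lemma rnorm_cvg_le (u : nat -> A) (l : A) (c : R) :
  u k @[k --> \oo] --> l -> (forall k, rnorm (u k) <= c) -> rnorm l <= c.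
Proof.
move=> /cvg_rnorm ul uc; rewrite -subr_le0.
apply: (@ler_cvg_to _ _ _ _ (fun=> rnorm l - c) _ _ _ (cvg_cst _) ul).
apply: nearW => k; have := ler_rnormB (u k) (u k - l); rewrite subKr.
have := uc k; lra.
Qed.

Lemma idem_rnorm_lt1 e : e * e = e -> rnorm e < 1 -> e = 0.
Proof.
move=> ee e1; apply: rnorm0_eq0; have := ler_rnormM e e.
by rewrite ee; have := rnorm_ge0 e; nra.
Qed.

(* The quotients for [t *: x] converge to an idempotent which is [1] at [t = 0]
   and depends continuously on [t], hence is [1] throughout. *)
Lemma cvg_dyadic_expr x :
    (forall z, rnorm z <= 1 -> 1 - z *: x \is a GRing.unit) ->
  x ^+ (2 ^ k) @[k --> \oo] --> (0 : A).
Proof.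
move=> xU.
have sq1 z : rnorm z ^+ 2 <= 1 -> rnorm z <= 1.
  by rewrite expr_le1 // rnorm_ge0.
have [|M MP] := @bounded_resolvent R A 0 1 x.
  by move=> z /andP[_ /sq1]; exact: xU.
have {}MP z : rnorm z <= 1 -> rnorm (1 - z *: x)^-1 <= M.
  by move=> z1; apply: MP; rewrite sqr_ge0 expr_le1 // rnorm_ge0.
have M0 : 0 <= M by apply: le_trans (MP 0 _); rewrite ?rnorm_ge0 ?rnorm0.
pose L := M * rnorm x * M.
have L0 : 0 <= L by rewrite !mulr_ge0 ?rnorm_ge0.
pose xt (t : R) := t%:C *: x.
have comm1 t : GRing.comm 1 (xt t) by exact/commr_sym/commr1.
have tU t : 0 <= t <= 1 -> forall z, rnorm z <= 1 -> rnorm (z * t%:C) <= 1.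
  move=> /andP[t0 t1] z z1; rewrite rnormMc rnormC ger0_norm //.
  have := rnorm_ge0 z; nra.
have cU t : 0 <= t <= 1 -> circle_unit 1 (xt t).
  by move=> t01 z z1; rewrite /xt scalerA xU // tU // z1.
have dist s t : 0 <= s <= 1 -> 0 <= t <= 1 -> forall k z, rnorm z = 1 ->
    rnorm (dyadic_quot 1 (xt s) k z - dyadic_quot 1 (xt t) k z) <= L * `|t - s|.
  move=> s01 t01.
  apply: (dyadic_quot_dist (comm1 s) (cU s s01) (comm1 t) (cU t t01)) => z z1.
  rewrite /dyadic_quot /dyadic_den !expr1 !mul1r.
  apply: le_trans (rnorm_invrB (cU _ s01 _ z1) (cU _ t01 _ z1)) _.
  have -> : 1 - z *: xt s - (1 - z *: xt t) = (z * (t - s)%:C) *: x.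
    rewrite opprB addrC addrA subrK /xt !scalerA -scalerBl -mulrBr.
    by rewrite rmorphB.
  rewrite rnormZ rnormMc rnormC z1 mul1r /L.
  have ab : rnorm (1 - z *: xt s)^-1 * rnorm (1 - z *: xt t)^-1 <= M * M.
    by rewrite ler_pM ?rnorm_ge0 // /xt scalerA MP // tU // z1.
  have c0 : 0 <= `|t - s| * rnorm x by rewrite mulr_ge0 ?rnorm_ge0.
  have := ler_wpM2l c0 ab; lra.
(* On a grid of mesh [1 / (m + 1)] with [L < m + 1], consecutive limits differ by less than [1], and
   an idempotent [1 - e] of norm below [1] vanishes. *)
have [m mL] : exists m : nat, L < m.+1%:R.
  by exists (Num.truncn L); rewrite truncnS_gt.
have m0 : 0 < m.+1%:R :> R by [].
have step j : (j <= m.+1)%N ->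
    dyadic_quot 1 (xt (j%:R / m.+1%:R)) k 1 @[k --> \oo] --> (1 : A).
  have j01 i : (i <= m.+1)%N -> 0 <= (i%:R / m.+1%:R : R) <= 1.
    by move=> im; rewrite divr_ge0 //= ler_pdivrMr // mul1r ler_nat.
  elim: j => [_|j IH jm].
    rewrite mul0r /xt scale0r.
    have -> : (fun k => dyadic_quot (1 : A) 0 k 1) = fun=> 1.
      apply/funext => k; rewrite /dyadic_quot /dyadic_den expr1n expr0n.
      by rewrite expn_eq0 /= scaler0 subr0 divr1.
    exact: cvg_cst.
  have [e [de _ ee]] := dyadic_quot_cvg (comm1 _) (cU _ (j01 _ jm)).
  suff e1 : 1 - e = 0 by rewrite -(subr0_eq e1) in de.
  apply: idem_rnorm_lt1; first by rewrite mulrBr mulr1 mulrBl mul1r ee subrr subr0.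
  apply: (@le_lt_trans _ _ (L / m.+1%:R)); last by rewrite ltr_pdivrMr // mul1r.
  apply: (rnorm_cvg_le (cvgB (IH (ltnW jm)) de)) => k.
  have := dist _ _ (j01 _ (ltnW jm)) (j01 _ jm) k 1 (rnorm1 R).
  by rewrite -mulrBl -natrB // subSnn mul1r gtr0_norm // invr_gt0.
have := step m.+1 (leqnn _); rewrite divff ?gt_eqF // /xt scale1r => /cvg_rnorm F1.
(* With [F] the quotient at [1] and [n = 2 ^ k], [x ^+ n = (F - 1) * (1 - x ^+ n)]; once
   [rnorm (F - 1) <= 2^-1], this bounds the norm of [x ^+ n] by [2 * rnorm (F - 1)]. *)
apply: (@cvg_rnorm_le _ _ _ _
  (fun k => 2 * rnorm (dyadic_quot 1 x k 1 - 1))).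
  by rewrite -[0](mulr0 2); apply: cvgMl_tmp.
move/cvgr0Pnorm_le : F1 => /(_ 2^-1 ltac:(by rewrite invr_gt0)).
apply: filterS => k; rewrite ger0_norm ?rnorm_ge0 // subr0 => F2.
have dU : 1 - x ^+ (2 ^ k) \is a GRing.unit.
  have := dyadic_den_unit (comm1 1) (cU 1 _) k (rnorm1 R).
  by rewrite /dyadic_den /xt !scale1r expr1n; apply; rewrite ler01 lexx.
have xE : x ^+ (2 ^ k) = (dyadic_quot 1 x k 1 - 1) * (1 - x ^+ (2 ^ k)).
  rewrite /dyadic_quot /dyadic_den scale1r expr1n mul1r mulrBl mulVr // mul1r.
  by rewrite opprB addrC subrK.
have := ler_rnormM (dyadic_quot 1 x k 1 - 1) (1 - x ^+ (2 ^ k)).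
rewrite -xE; have := ler_rnormB (1 : A) (x ^+ (2 ^ k)); rewrite rnormA1.
have := rnorm_ge0 (x ^+ (2 ^ k)); have := rnorm_ge0 (dyadic_quot 1 x k 1 - 1).
nra.
Qed.

Lemma cayley_denE x z : z != 1 ->
  x + 1 - z *: (x - 1) = (z - 1) *: (((z + 1) / (z - 1))%:A - x).
Proof.
move=> z1; rewrite [RHS]scalerBr scalerA mulrCA mulfV ?subr_eq0 // mulr1.
rewrite scalerDl scale1r scalerBl scale1r scalerBr !opprB.
by rewrite [_ *: 1 + 1]addrC [RHS]addrACA [1 + x]addrC.
Qed.

(** The sign of the right side is what matters: the unit circle goes to the imaginary axis and the
    closed disc to the closed left half plane. *)
Lemma Re_cayley z : z != 1 ->
  complex.Re ((z + 1) / (z - 1)) = (rnorm z ^+ 2 - 1) / rnorm (z - 1) ^+ 2.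
Proof.
move=> z1.
have : 0 < rnorm (z - 1) ^+ 2.
  rewrite exprn_gt0 // lt_neqAle rnorm_ge0 andbT eq_sym.
  by apply: contra z1 => /eqP /rnorm0_eq0 /subr0_eq ->.
rewrite !sqr_rnorm; case: z z1 => s t z1 /=.
by rewrite oppr0 !addr0 => n0; field; rewrite gt_eqF.
Qed.

(** At [z = 1], the preimage of infinity, the element is the scalar [2]; elsewhere [cayley_denE]
    applies. *)
Lemma cayley_den_unit x z :
    (z != 1 -> ((z + 1) / (z - 1))%:A - x \is a GRing.unit) ->
  x + 1 - z *: (x - 1) \is a GRing.unit.
Proof.
have [-> _|z1 /(_ isT) xU] := eqVneq z 1.
  rewrite scale1r opprB addrC addrA subrK -[1 + 1]/(1 *+ 2) -[1 *+ 2]scaler_nat.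
  by rewrite scaler_unit ?unitr1 // unitfE pnatr_eq0.
by rewrite cayley_denE // scaler_unit ?unitfE ?subr_eq0.
Qed.

Lemma spectrum_rhpP x : spectrum x `<=` [set z | 0 < complex.Re z] <->
  forall z, complex.Re z <= 0 -> z%:A - x \is a GRing.unit.
Proof.
split=> [xP z z0|xU z /= zx].
  by have [//|/xP /=] := boolP (z%:A - x \is a GRing.unit); rewrite ltNge z0.
by rewrite ltNge; apply: contra zx; exact: xU.
Qed.

Section Rhp.
Variable x : A.
Hypothesis xP : spectrum x `<=` [set z | 0 < complex.Re z].

Lemma rhp_unit : x \is a GRing.unit.
Proof.
by have /spectrum_rhpP/(_ 0 (lexx _)) := xP; rewrite scale0r sub0r unitrN.
Qed.

Lemma rhp_unitD1 : x + 1 \is a GRing.unit.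
Proof.
have /spectrum_rhpP/(_ (-1)) := xP; rewrite scaleN1r -opprD unitrN addrC; apply.
by rewrite /= oppr_le0 ler01.
Qed.

Lemma rhp_cayley_unit z : rnorm z <= 1 -> 1 - z *: cayley x \is a GRing.unit.
Proof.
move=> z1; have xU := rhp_unitD1.
rewrite -[1](mulrV xU) scalerAl -mulrBl unitrMl ?unitrV //.
apply: cayley_den_unit => z1'; move/spectrum_rhpP : xP; apply.
rewrite Re_cayley // mulr_le0_ge0 ?invr_ge0 ?sqr_ge0 //.
by rewrite subr_le0 expr_le1 // rnorm_ge0.
Qed.

Lemma cvg_cayley_expr : cayley x ^+ (2 ^ k) @[k --> \oo] --> (0 : A).
Proof. exact/cvg_dyadic_expr/rhp_cayley_unit. Qed.

End Rhp.

(** The relation gives [(x - 1) * d = - (d * (y + 1))] and [d * (y - 1) = - ((x + 1) * d)]. Acting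
    on [d] from opposite sides suits two square roots that may fail to commute. *)
Lemma cayley_sandwich x y d : x + 1 \is a GRing.unit -> y + 1 \is a GRing.unit ->
  x * d = - (d * y) -> d = cayley x * d * cayley y.
Proof.
move=> xU yU xdy.
have E1 : (x - 1) * d = - (d * (y + 1)).
  by rewrite mulrBl mul1r xdy mulrDr mulr1 opprD.
have E2 : d * (y - 1) = - ((x + 1) * d).
  by rewrite mulrDl mul1r xdy opprD opprK mulrBr mulr1.
have comm1 (w : A) : GRing.comm (w + 1) (w - 1).
  apply: commrB; last exact: commr1.
  exact/commr_sym/commrD/commr1/commr_refl.
rewrite /cayley; have -> : (x - 1) * (x + 1)^-1 = (x + 1)^-1 * (x - 1).
  exact/commrV/commr_sym.
rewrite -(mulrA _ (x - 1)) E1 mulrN mulNr -mulrA -(mulrA d) (mulrA (y + 1)).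
by rewrite comm1 mulrK // E2 mulrN opprK mulKr.
Qed.

Lemma principal_sqrt_uniq x y y' :
  is_principal_sqrt x y -> is_principal_sqrt x y' -> y = y'.
Proof.
move=> [yx yP] [y'x y'P]; apply/eqP; rewrite -subr_eq0; apply/eqP.
set d := y - y'.
have yd : y * d = - (d * y').
  by rewrite mulrBr mulrBl opprB -!expr2 yx y'x.
have dE := cayley_sandwich (rhp_unitD1 yP) (rhp_unitD1 y'P) yd.
have dX n : d = cayley y ^+ n * d * cayley y' ^+ n.
  elim: n => [|n IH]; first by rewrite !expr0 mul1r mulr1.
  by rewrite exprSr exprS {1}IH {1}dE !mulrA.
have := cvg_mul (cvg_mul (cvg_cayley_expr yP) (cvg_cst d)) (cvg_cayley_expr y'P).
rewrite mulr0; under eq_fun do rewrite -dX.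
move=> /(_ _) d0; apply: (@cvg_unique A (@norm_hausdorff _ A) _ _ _ _ _ d0).
exact: cvg_cst.
Qed.

End SpectralRadius.

(** * Dichotomy *)

Section Dichotomy.
Variables (R : realType) (A : banachAlgebra R[i]).
Implicit Types (x y e p q : A) (z t : R[i]).

Lemma cvg_comm (u : nat -> A) (l x : A) :
  u k @[k --> \oo] --> l -> (forall k, GRing.comm x (u k)) -> GRing.comm x l.
Proof.
move=> ul xu; have xl : x * u k @[k --> \oo] --> x * l.
  by apply: cvg_mul => //; exact: cvg_cst.
have lx : x * u k @[k --> \oo] --> l * x.
  by under eq_fun do rewrite xu; apply: cvg_mul => //; exact: cvg_cst.
exact: (@cvg_unique A (@norm_hausdorff _ A) _ _ _ _ xl lx).
Qed.

Lemma rnormXc z n : rnorm (z ^+ n) = rnorm z ^+ n.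
Proof. by elim: n => [|n IH]; rewrite ?expr0 ?rnorm1 // !exprS rnormMc IH. Qed.

Lemma circle_unitC p q : circle_unit p q -> circle_unit q p.
Proof.
move=> pqU z z1.
have z0 : z != 0 by apply: contra_eq_neq z1 => ->; rewrite rnorm0 eq_sym oner_neq0.
have -> : q - z *: p = - z *: (p - z^-1 *: q).
  by rewrite scalerBr scalerA mulNr mulfV // scaleN1r opprK scaleNr addrC.
rewrite scaler_unit ?unitfE ?oppr_eq0 // pqU //.
by rewrite -[LHS]mul1r -[X in X * _]z1 -rnormMc mulfV // rnorm1.
Qed.

(** At [z = 1], swapping [p] and [q] flips the sign of the denominator; in the limit [e] becomes the
    complementary idempotent. *)
Lemma dyadic_quotC p q k : dyadic_den p q k 1 \is a GRing.unit ->
  dyadic_quot q p k 1 = 1 - dyadic_quot p q k 1.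
Proof.
move=> dU; rewrite /dyadic_quot.
have -> : dyadic_den q p k 1 = - dyadic_den p q k 1.
  by rewrite /dyadic_den !scale1r opprB.
rewrite invrN mulrN -mulNr -[X in _ = X - _](mulrV dU) -mulrBl; congr (_ * _).
by rewrite /dyadic_den scale1r addrAC subrr add0r.
Qed.

Lemma commr_subZ p q t x : GRing.comm x p -> GRing.comm x q ->
  GRing.comm x (p - t *: q).
Proof. by move=> xp xq; apply: commrB => //; exact: commrZ. Qed.

(* On the range of [e] one has [|p| > |q|], so [p - t *: q] is invertible there:
   [p ^+ n - (t *: q) ^+ n] is a multiple of it, and dividing by
   [p ^+ n - q ^+ n] gives a limit [e]. *)
Lemma dyadic_corner p q e t : GRing.comm p q -> circle_unit p q ->
    dyadic_quot p q k 1 @[k --> \oo] --> e -> rnorm t <= 1 ->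
  exists w : nat -> A,
    (forall x k, GRing.comm x p -> GRing.comm x q -> GRing.comm x (w k)) /\
    (p - t *: q) * w k @[k --> \oo] --> e.
Proof.
move=> pq pqU pqe; rewrite le_eqVlt => /orP[/eqP t1|t1].
  exists (fun=> (p - t *: q)^-1 * e); split=> [x _ xp xq|].
    apply: commrM; first exact/commrV/commr_subZ.
    by apply: (cvg_comm pqe) => k; exact: commr_dyadic_quot.
  by rewrite mulVKr ?pqU //; exact: cvg_cst.
pose w k := (\sum_(i < 2 ^ k) p ^+ ((2 ^ k).-1 - i) * (t *: q) ^+ i) *
  (dyadic_den p q k 1)^-1.
exists w; split=> [x k xp xq|].
  apply: commrM; last exact/commrV/commr_dyadic_den.
  by apply: commr_sum => i _; apply: commrM; apply: commrX => //; exact: commrZ.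
(* With [n = 2 ^ k], [q ^+ n] over [p ^+ n - q ^+ n] is the quotient minus [1]; it stays bounded, so
   the correction dies out with [t ^+ n]. *)
have wE k : (p - t *: q) * w k =
    dyadic_quot p q k 1 - t ^+ (2 ^ k) *: (dyadic_quot p q k 1 - 1).
  rewrite /w mulrA -subrXX_comm; last exact: commrZ.
  rewrite exprZn mulrBl -scalerAl; congr (_ - _ *: _).
  have dU : dyadic_den p q k 1 \is a GRing.unit by rewrite dyadic_den_unit ?rnorm1.
  rewrite -[X in _ = _ - X](mulrV dU) -mulrBl; congr (_ * _).
  by rewrite /dyadic_den scale1r subKr.
rewrite (funext wE) -[e in X in _ --> X]subr0; apply: cvgB => //.
have [M MP] := cvg_rnorm_bounded (cvgB pqe (cvg_cst (1 : A))).
apply: (@cvg_rnorm_le _ _ _ _ (fun k => rnorm t ^+ k * M)).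
  rewrite -[0](mul0r M); apply: cvgMr_tmp; apply: cvg_expr.
  by rewrite ger0_norm ?rnorm_ge0.
apply: nearW => k; rewrite subr0 rnormZ rnormXc.
apply: ler_pM; rewrite ?exprn_ge0 ?rnorm_ge0 ?MP //.
apply: ler_wiXn2l; rewrite ?rnorm_ge0 ?(ltW t1) //; exact/ltnW/ltn_expl.
Qed.

(** The element acts as [p - t *: q] on the range of [e] and as [- (q - t *: p)] on that of [1 - e].
    The two corner sequences combine into [y k] with [T * y k] tending to [1]; a term close to [1]
    is a unit, hence so are its commuting factors. *)
Lemma dichotomy_unit p q e t : GRing.comm p q -> circle_unit p q ->
    dyadic_quot p q k 1 @[k --> \oo] --> e -> e * e = e -> rnorm t <= 1 ->
  (p - t *: q) * e - (q - t *: p) * (1 - e) \is a GRing.unit.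
Proof.
move=> pq pqU pqe ee t1.
have ce x : GRing.comm x p -> GRing.comm x q -> GRing.comm x e.
  by move=> xp xq; apply: (cvg_comm pqe) => k; exact: commr_dyadic_quot.
have qpe : dyadic_quot q p k 1 @[k --> \oo] --> 1 - e.
  under eq_fun do rewrite dyadic_quotC ?dyadic_den_unit ?rnorm1 //.
  by apply: cvgB => //; exact: cvg_cst.
have [w [wc we]] := dyadic_corner pq pqU pqe t1.
have [w' [wc' we']] := dyadic_corner (commr_sym pq) (circle_unitC pqU) qpe t1.
set u := p - t *: q in we *; set v := q - t *: p in we' *.
set T := u * e - v * (1 - e).
have pe : GRing.comm p e by apply: ce.
have qe : GRing.comm q e by apply: ce => //; exact: commr_sym.
have uT x : GRing.comm x p -> GRing.comm x q -> GRing.comm x T.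
  move=> xp xq; have xe := ce _ xp xq.
  apply: commrB; apply: commrM; try exact: commr_subZ; try by [].
  by apply: commrB => //; exact: commr1.
pose y k := w k * e - w' k * (1 - e).
have TE k : T * y k = (u * w k) * e + (v * w' k) * (1 - e).
  have e1 : e * (1 - e) = 0 by rewrite mulrBr mulr1 ee subrr.
  have e1' : (1 - e) * e = 0 by rewrite mulrBl mul1r ee subrr.
  have e2 : (1 - e) * (1 - e) = 1 - e by rewrite mulrBl mul1r e1 subr0.
  have ep := commr_sym pe; have eq := commr_sym qe.
  have ew : GRing.comm e (w k) by exact: wc.
  have ew' : GRing.comm e (w' k) by exact: wc'.
  have fw x : GRing.comm e x -> GRing.comm (1 - e) x.
    by move=> ex; apply/commr_sym/commrB; [exact: commr1|exact: commr_sym].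
  have mv (g c a b : A) : GRing.comm g c -> a * g * (c * b) = a * c * (g * b).
    by move=> gc; rewrite -!mulrA (mulrA g) gc -!mulrA.
  rewrite /T /y; move: (1 - e) e1 e1' e2 fw => f ef fe ff fw.
  rewrite mulrBl !mulrBr (mv _ _ _ _ ew) (mv _ _ _ _ ew').
  rewrite (mv _ _ _ _ (fw _ ew)) (mv _ _ _ _ (fw _ ew')).
  by rewrite ee ef fe ff !mulr0 subr0 sub0r opprK.
have T1 : T * y k @[k --> \oo] --> (1 : A).
  rewrite (funext TE) -[1 in X in _ --> X](_ : e * e + (1 - e) * (1 - e) = 1).
    by apply: cvgD; apply: cvg_mul => //; exact: cvg_cst.
  by rewrite mulrBr mulr1 mulrBl mul1r ee subrr subr0 addrC subrK.
move/cvg_rnorm/cvgr0Pnorm_lt : T1 => /(_ 1 ltr01) [k _ /(_ k (leqnn k))] /=.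
rewrite ger0_norm ?rnorm_ge0 // rdistC => /unitr_sub1; rewrite subKr.
rewrite unitrM_comm; first by case/andP.
have Tp : GRing.comm T p by exact/commr_sym/uT.
have Tq : GRing.comm T q by apply/commr_sym/uT => //; exact: commr_sym.
apply: commrB; apply: commrM; try exact: wc; try exact: wc'; try exact: ce.
by apply: commrB; [exact: commr1|exact: ce].
Qed.

End Dichotomy.

(** * Newton iteration *)

Section Newton.
Variables (R : realType) (A : banachAlgebra R[i]).
Implicit Types a s : A.

(** Serves twice: with [a + 1], [a - 1] for [a] itself, and with [1], [G0] for [N]. *)
Lemma newton_dyadic_base a (p q : A) : p - q \is a GRing.unit ->
  p + q = a * (p - q) -> 2 *: dyadic_quot p q 0 1 - 1 = a.
Proof.
move=> dU pqa; rewrite /dyadic_quot /dyadic_den !expr1 scale1r.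
rewrite -[X in _ - X](mulrV dU) scalerAl -mulrBl.
have -> : 2 *: p - (p - q) = p + q.
  by rewrite scaler_nat mulr2n opprB addrACA addrN addr0.
by rewrite pqa mulrK.
Qed.

Lemma involution_invr s : s * s = 1 -> s \is a GRing.unit /\ s^-1 = s.
Proof.
move=> ss; have sU : s \is a GRing.unit by apply/unitrP; exists s.
by split=> //; rewrite -[RHS]mul1r -(mulVr sU) -mulrA ss mulr1.
Qed.

(** An involution commuting with [a] commutes with every iterate and is its own inverse, so it
    factors out of both summands. *)
Lemma newton_iter_mul a s k : GRing.comm a s -> s * s = 1 ->
    (forall k, newton_iter a k \is a GRing.unit) ->
  newton_iter (a * s) k = newton_iter a k * s.
Proof.
move=> as_ ss aU; have [sU sV] := involution_invr ss.
have comm j : GRing.comm s (newton_iter a j).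
  elim: j => [|j IH] /=; first exact: commr_sym.
  by apply: commrZ; apply: commrD => //; exact: commrV.
elim: k => //= k ->; rewrite invrM // sV -scalerAl mulrDl.
by congr (_ *: (_ + _)); apply: commrV; exact: comm.
Qed.

(** As [s * s = 1], [(a - s) ^+ 2 = a * (a - s - s) + 1]; multiplying by [a^-1] leaves
    [a + a^-1 - (s + s)]. *)
Lemma newton_iter_error a s : a \is a GRing.unit -> GRing.comm a s -> s * s = 1 ->
  2^-1 *: (a + a^-1) - s = 2^-1 *: (a^-1 * (a - s) ^+ 2).
Proof.
move=> aU as_ ss.
have -> : (a - s) ^+ 2 = a * (a - s - s) + 1.
  rewrite expr2 mulrBr !mulrBl -as_ ss !mulrBr opprB addrA.
  by rewrite [LHS]addrAC.
rewrite mulrDr mulKr // mulr1.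
have sE : s = 2^-1 *: (s + s) by rewrite scalerDr -scalerDl -splitr1 scale1r.
rewrite [s in LHS]sE -scalerBr; congr (_ *: _).
by rewrite [LHS]addrAC opprD addrA.
Qed.

End Newton.

Theorem theorem3p4 (R : realType) (A : banachAlgebra R[i]) (a : A)
    (ha : spectrum a `&` [set z : R[i] | complex.Re z = 0] = set0) :
  let S := sign_of a in
  let X := newton_iter a in
  let N := principal_sqrt (a ^+ 2) in
  let G0 := cayley N in
  (* all the inverses occurring in the statement exist *)
  [/\ N \is a GRing.unit, N + 1 \is a GRing.unit,
      forall k : nat, X k \is a GRing.unit
    & forall k : nat, (1 <= k)%N -> 1 - G0 ^+ (2 ^ k) \is a GRing.unit] /\
  [/\ X k @[k --> \oo] --> S,
      (X k)^-1 @[k --> \oo] --> S,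
      forall k : nat,
        `|X k.+1 - S| <= 2^-1 * `|(X k)^-1| * `|X k - S| ^+ 2
    & forall k : nat, (1 <= k)%N ->
        X k = (1 - G0 ^+ (2 ^ k))^-1 * (1 + G0 ^+ (2 ^ k)) * S].
Proof.
have axU z : complex.Re z = 0 -> z%:A - a \is a GRing.unit.
  move=> z0; apply: contrapT => /negP za.
  have : (spectrum a `&` [set z : R[i] | complex.Re z = 0]) z by [].
  by rewrite ha.
have aU : a \is a GRing.unit by have := axU 0 erefl; rewrite scale0r sub0r unitrN.
pose p := a + 1; pose q := a - 1.
have ap : GRing.comm a p by apply: commrD => //; exact: commr1.
have aq : GRing.comm a q by apply: commrB => //; exact: commr1.
have pq : GRing.comm p q.
  by apply: commrB; [exact: commr_sym|exact: commr1].
have pqU : circle_unit p q.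
  move=> z z1; apply: cayley_den_unit => z1'; apply: axU.
  by rewrite Re_cayley // z1 expr1n subrr mul0r.
have pqE : p - q = 2 *: (1 : A).
  by rewrite /p /q opprB addrC addrA subrK scaler_nat.
have XE k : newton_iter a k = 2 *: dyadic_quot p q k 1 - 1.
  rewrite -newton_iter_dyadic // (@newton_dyadic_base _ _ a) //.
    by have := pqU 1 (rnorm1 R); rewrite scale1r.
  by rewrite pqE -scalerAr mulr1 /p /q addrACA subrr addr0 scaler_nat.
have XU k : newton_iter a k \is a GRing.unit.
  by rewrite XE; case: (dyadic_newton_invr pq pqU k).
have XVE k : (newton_iter a k)^-1 = 2 *: dyadic_quot p q k (- 1) - 1.
  by rewrite XE; case: (dyadic_newton_invr pq pqU k).
have [e [pqe pqe' ee]] := dyadic_quot_cvg pq pqU.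
have ae : GRing.comm a e.
  by apply: (cvg_comm pqe) => k; exact: commr_dyadic_quot.
pose s := 2 *: e - 1.
have as_ : GRing.comm a s by apply: commrB; [exact: commrZ|exact: commr1].
have ss : s * s = 1.
  rewrite /s scaler_nat mulr2n mulrBr mulr1 mulrBl mul1r mulrDl !mulrDr !ee.
  by rewrite addrK opprB addrC subrK.
have [sU sV] := involution_invr ss.
have sqrtP : is_principal_sqrt (a ^+ 2) (a * s).
  split; first by rewrite exprMn_comm // [s ^+ 2]ss mulr1.
  apply/spectrum_rhpP => z z0.
  have z1 : z != 1 by apply: contraTneq z0 => ->; rewrite /= -ltNge ltr01.
  (* This involution takes the closed left half plane into the closed disc; the element of
     [dichotomy_unit] at [t] is then a nonzero multiple of [z%:A - a * s]. *)
  pose t := (z + 1) / (z - 1).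
  have d0 : 0 < rnorm (z - 1).
    rewrite lt_neqAle rnorm_ge0 andbT eq_sym; apply: contra z1.
    by move=> /eqP/rnorm0_eq0/subr0_eq ->.
  have t1 : rnorm t <= 1.
    rewrite -(ler_pM2r d0) mul1r -rnormMc divfK ?subr_eq0 //.
    have := sqr_rnorm (z + 1); have := sqr_rnorm (z - 1).
    case: (z) z0 => u v /= u0; have := rnorm_ge0 (u +i* v + 1).
    have := rnorm_ge0 (u +i* v - 1); nra.
  have := dichotomy_unit pq pqU pqe ee t1.
  have -> : (p - t *: q) * e - (q - t *: p) * (1 - e) =
    (2 / (z - 1)) *: (z%:A - a * s).
    have z1' : z - 1 != 0 by rewrite subr_eq0.
    set c := 2 / (z - 1).
    have tc : 1 - t = - c by rewrite /t /c; field.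
    have tc' : 1 + t = c * z by rewrite /t /c; field.
    have -> : p - t *: q = c *: (z%:A - a).
      rewrite [RHS]scalerBr scalerA -tc' -[- (c *: a)]scaleNr -tc /p /q.
      rewrite scalerBr scalerBl scalerDl !scale1r opprB.
      by rewrite [RHS]addrACA [1 + a]addrC.
    have -> : q - t *: p = - (c *: (z%:A + a)).
      rewrite [c *: _]scalerDr scalerA -tc' opprD -[- (c *: a)]scaleNr -tc /p /q.
      rewrite scalerDr scalerBl scalerDl !scale1r !opprD [LHS]addrACA.
      by rewrite [RHS]addrC.
    rewrite mulNr opprK -!scalerAl -scalerDr; congr (_ *: _).
    (* The corners [(z - a) e] and [(z + a) (1 - e)] add up to [z - a (2 e - 1)]. *)
    have -> : z%:A - a = z%:A + a - (a + a) by rewrite opprD addrA addrK.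
    rewrite mulrBl addrAC -mulrDr [e + _]addrC subrK mulr1.
    by rewrite /s scaler_nat mulr2n mulrBr mulr1 opprB mulrDl mulrDr addrA.
  rewrite scaler_unit // unitfE mulf_neq0 ?invr_eq0 ?subr_eq0 ?pnatr_eq0 //.
(* The witness [a * s] rules out the default value of [xget]; uniqueness then identifies the chosen
   root. *)
have NE : principal_sqrt (a ^+ 2) = a * s.
  by apply: (principal_sqrt_uniq (xgetPex _ _) sqrtP); exists (a * s).
have SE : sign_of a = s.
  by rewrite /sign_of NE as_ invrM // sV mulrA mulrV // mul1r.
case: (sqrtP) => _ rhp.
rewrite SE NE => S X N G0.
have GU z : rnorm z <= 1 -> 1 - z *: G0 \is a GRing.unit by exact: rhp_cayley_unit.
have G1U : circle_unit 1 G0 by move=> z z1; rewrite GU // z1.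
have c1G : GRing.comm 1 G0 by exact/commr_sym/commr1.
have GkU k : 1 - G0 ^+ (2 ^ k) \is a GRing.unit.
  by have := dyadic_den_unit c1G G1U k (rnorm1 R); rewrite /dyadic_den scale1r expr1n.
have NU : N + 1 \is a GRing.unit by exact: rhp_unitD1.
split; first by split=> //; exact: rhp_unit.
split.
- rewrite /X (funext XE); apply: cvgB; last exact: cvg_cst.
  exact: cvgZl_tmp.
- under eq_fun do rewrite /X XVE.
  apply: cvgB; last exact: cvg_cst.
  exact: cvgZl_tmp.
- move=> k; have Xs : GRing.comm (X k) s.
    rewrite /X XE; apply/commr_sym/commrB; last exact: commr1.
    apply: commrZ; apply: commr_dyadic_quot; have sa := commr_sym as_.
      by apply: commrD => //; exact: commr1.
    by apply: commrB => //; exact: commr1.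
  rewrite /X /= newton_iter_error // normrZ ger0_norm ?invr_ge0 // -mulrA.
  rewrite ler_wpM2l ?invr_ge0 //.
  apply: le_trans (Defs.ler_normM _ _) _; rewrite ler_wpM2l //.
  rewrite expr2; exact: Defs.ler_normM.
(* Since [N = a * s] and [s * s = 1], the iterates of [a] are those of [N] times [s]. The pair [1],
   [G0] represents [N], with dyadic quotients [(1 - G0 ^+ (2 ^ k))^-1] at [1]. *)
- move=> k _; have -> : X k = newton_iter N k * s.
    by rewrite newton_iter_mul // -mulrA ss mulr1.
  congr (_ * _).
  rewrite -[N](@newton_dyadic_base _ _ N 1 G0).
  + rewrite newton_iter_dyadic // /dyadic_quot /dyadic_den expr1n mul1r scale1r.
    rewrite -[X in _ - X](mulVr (GkU k)) -[X in _ *: X]mulr1 scalerAr -mulrBr.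
    by rewrite scaler_nat mulr2n opprB addrACA subrr addr0.
  + by have := GU 1; rewrite scale1r rnorm1; apply.
  + have v1 := esym (mulrV NU).
    rewrite /G0 /cayley [X in X + _ = _]v1 [X in _ = N * (X - _)]v1.
    rewrite -mulrDl -mulrBl mulrA; congr (_ * _).
    rewrite addrACA subrr addr0 opprB [N + 1 + _ in RHS]addrC addrA subrK.
    by rewrite mulrDr mulr1.
Qed.
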